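(* Let $(\mathcal F_0,\mathbf a)$ be initial data for the completion problem in $\mathbb C^d$ with $\mathbf a=\mathbf a^\downarrow\in\mathbb R^k_{>0}$ and $d-k\le0$, and let $\lambda=\lambda^\uparrow(S_{\mathcal F_0})$. Then the vector $\nu=\nu_f(\lambda,\mathbf a)$ is the same for every strictly convex function $f:[0,\infty)\to[0,\infty)$. Therefore, with $\Lambda(\mathcal C_{\mathbf a}(\mathcal F_0))=\{\lambda(S_{\mathcal F}):\mathcal F\in\mathcal C_{\mathbf a}(\mathcal F_0)\}$, $$\nu^\downarrow\in\Lambda(\mathcal C_{\mathbf a}(\mathcal F_0))\quad\text{and}\quad \nu^\downarrow\prec\gamma\ \text{ for every }\gamma\in\Lambda(\mathcal C_{\mathbf a}(\mathcal F_0)).$$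
   Context: Notation. $\operatorname{tr}x=\sum_i x_i$; $x^\downarrow$ (resp. $x^\uparrow$) is the rearrangement of $x$ in decreasing (resp. increasing) order. For $x,y\in\mathbb R^m$, $x\prec y$ means $\sum_{i\le j}x_i^\downarrow\le\sum_{i\le j}y_i^\downarrow$ for all $j$ and $\operatorname{tr}x=\operatorname{tr}y$; for vectors of different sizes (non-negative entries) complete with zeros. For a finite sequence $\mathcal F=\{f_i\}$ in $\mathcal H=\mathbb C^d$, $S_{\mathcal F}=\sum_i f_i\otimes f_i$ is its frame operator, where $(x\otimes y)(z)=\langle z,y\rangle x$. For positive semidefinite $S$, $\lambda(S)=\lambda^\downarrow(S)$ (resp. $\lambda^\uparrow(S)$) is the vector of its eigenvalues with multiplicity in decreasing (resp. increasing) order. Initial data for the completion problem: a finite sequence $\mathcal F_0=\{f_i\}_{i=1}^{n_0}$ in $\mathcal H$ and $\mathbf a=(a_i)_{i=1}^k\in\mathbb R_{>0}^k$ with $a_1\ge\dots\ge a_k$ and $d-\operatorname{rk}S_{\mathcal F_0}\le k$. $\mathcal C_{\mathbf a}(\mathcal F_0)=\{(\mathcal F_0,\mathcal G):\mathcal G=\{g_i\}_{i=1}^k\subset\mathcal H,\ \|g_i\|^2=a_i\ (1\le i\le k)\}$ (juxtaposed sequences). Let $\Gamma_d(\mathbf a)=\{\gamma\in\mathbb R_{\ge0}^d:\gamma=\gamma^\downarrow,\ \mathbf a\prec\gamma\}$. For strictly convex $f:[0,\infty)\to[0,\infty)$ it is known that there is a unique $\mu_f(\lambda,\mathbf a)\in\Gamma_d(\mathbf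 a)$ minimizing $\gamma\mapsto\sum_{i=1}^d f(\lambda_i+\gamma_i)$ on $\Gamma_d(\mathbf a)$; set $\nu_f(\lambda,\mathbf a)=\lambda+\mu_f(\lambda,\mathbf a)$. A completion $\mathcal F=(\mathcal F_0,\mathcal G)\in\mathcal C_{\mathbf a}(\mathcal F_0)$ is a global minimizer of $P_f(\mathcal F)=\sum_{i=1}^d f(\lambda_i(S_{\mathcal F}))$ on $\mathcal C_{\mathbf a}(\mathcal F_0)$ if and only if $\lambda(S_{\mathcal G})=\mu_f(\lambda,\mathbf a)$ and $\lambda(S_{\mathcal F})=\nu_f(\lambda,\mathbf a)^\downarrow$. *)

(* Defs.v *)
From HB Require Import structures.
From mathcomp Require Import all_boot all_order all_algebra.
From mathcomp Require Import spectral complex.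
From mathcomp Require Import classical_sets reals.

Set Implicit Arguments.
Unset Strict Implicit.
Unset Printing Implicit Defensive.

Import Order.TTheory GRing.Theory Num.Theory.

Local Open Scope classical_set_scope.
Local Open Scope ring_scope.
Local Open Scope complex_scope.
Local Open Scope sesquilinear_scope.

Section Vectors.
Context {R : realType}.
Implicit Types m n : nat.

Definition tr {m} (x : 'rV[R]_m) : R := \sum_i x 0 i.

Definition sort_decr {m} (x : 'rV[R]_m) : seq R :=
  sort (fun u v => v <= u) [seq x 0 i | i <- enum 'I_m].

Definition decr {m} (x : 'rV[R]_m) : 'rV[R]_m := \row_i (sort_decr x)`_i.

(* Majorization.  [s`_i] is 0 beyond the end of [s], so for vectors of
   different sizes (only used with nonnegative entries) the shorter one is
   completed with zeros; for equal sizes, the inequalities with j > m follow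
   from the equality of the traces. *)
Definition majorized {m n} (x : 'rV[R]_m) (y : 'rV[R]_n) : Prop :=
  (forall j : nat,
     \sum_(i < j) (sort_decr x)`_i <= \sum_(i < j) (sort_decr y)`_i)
  /\ tr x = tr y.

Definition strictly_convex_nonneg (f : R -> R) : Prop :=
  forall x y t : R, 0 <= x -> 0 <= y -> x != y -> 0 < t < 1 ->
    f ((1 - t) * x + t * y) < (1 - t) * f x + t * f y.

Definition Gamma {d k : nat} (a : 'rV[R]_k) : set 'rV[R]_d :=
  [set g : 'rV[R]_d | [/\ forall i, 0 <= g 0 i, g = decr g & majorized a g]].

Definition is_minimizer (f : R -> R) {d k}
    (lambda : 'rV[R]_d) (a : 'rV[R]_k) (mu : 'rV[R]_d) : Prop :=
  Gamma a mu /\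
  forall g, Gamma a g ->
    \sum_i f (lambda 0 i + mu 0 i) <= \sum_i f (lambda 0 i + g 0 i).

Definition is_mu (f : R -> R) {d k}
    (lambda : 'rV[R]_d) (a : 'rV[R]_k) (mu : 'rV[R]_d) : Prop :=
  unique (is_minimizer f lambda a) mu.

Definition is_nu (f : R -> R) {d k}
    (lambda : 'rV[R]_d) (a : 'rV[R]_k) (nu : 'rV[R]_d) : Prop :=
  exists2 mu, is_mu f lambda a mu & nu = lambda + mu.

End Vectors.

Notation "x ≺ y" := (majorized x y) (at level 70, no associativity).

Section Frames.
Context {R : realType}.
Implicit Types d k n : nat.

Definition sqnorm {d} (g : 'cV[R[i]]_d) : R[i] := \sum_i `|g i 0| ^+ 2.

(* [f *m f ^t*] is the matrix of f ⊗ f : z |-> <z, f> f. *)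
Definition frame_op {d} (F : seq 'cV[R[i]]_d) : 'M[R[i]]_d :=
  \sum_(f <- F) f *m f ^t*.

(* The roots of the characteristic polynomial, with multiplicity. *)
Definition char_roots {d} (S : 'M[R[i]]_d) : seq R[i] :=
  sval (closed_field_poly_normal (char_poly S)).

(* Only used for positive semidefinite matrices, whose eigenvalues are real:
   taking real parts just brings them from R[i] to R. *)
Definition eig_decr {d} (S : 'M[R[i]]_d) : 'rV[R]_d :=
  \row_i (sort (fun u v => v <= u) [seq complex.Re z | z <- char_roots S])`_i.

Definition eig_incr {d} (S : 'M[R[i]]_d) : 'rV[R]_d :=
  \row_i (sort (fun u v => u <= v) [seq complex.Re z | z <- char_roots S])`_i.

Definition initial_data {d n0 k}
    (F0 : n0.-tuple 'cV[R[i]]_d) (a : 'rV[R]_k) : Prop :=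
  [/\ forall i, 0 < a 0 i, a = decr a & (d - \rank (frame_op F0) <= k)%N].

Definition completions {d n0 k}
    (F0 : n0.-tuple 'cV[R[i]]_d) (a : 'rV[R]_k) :
    set ((n0 + k).-tuple 'cV[R[i]]_d) :=
  [set F : (n0 + k).-tuple _ | exists2 G : k.-tuple 'cV[R[i]]_d,
     (forall i, sqnorm (tnth G i) = (a 0 i)%:C) & F = [tuple of F0 ++ G]].

Definition Lambda {d n0 k}
    (F0 : n0.-tuple 'cV[R[i]]_d) (a : 'rV[R]_k) : set 'rV[R]_d :=
  [set eig_decr (frame_op F) | F in completions F0 a].

End Frames.

(* Main.v *)
Require Import Defs.
From HB Require Import structures.
From mathcomp Require Import all_boot all_order all_algebra.
From mathcomp Require Import perm spectral complex.
From mathcomp Require Import boolp functions classical_sets reals.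
From mathcomp Require Import topology normedtype derive.
From mathcomp Require Import ring lra.

Set Implicit Arguments.
Unset Strict Implicit.
Unset Printing Implicit Defensive.

Import Order.TTheory GRing.Theory Num.Theory.
Import numFieldNormedType.Exports.
Local Open Scope ring_scope.

(** Write lam for the increasing spectrum of the initial frame operator and
    A_p for the sum of the p largest prescribed squared norms.  The vector nu
    comes from one quadratic problem: minimize the sum of the
    (lam_i + g_i)^2 over the polytope of the nonnegative g with total mass
    tr a whose prefix sums dominate the A_p ([polytope]); the minimum mu
    exists by compactness.  If nu_j < nu_i and mu_i > 0, moving a little mass
    from i to j would decrease the objective, so a prefix constraint
    separating i from j must be tight ([minimizer_exchange]).  As lam
    increases, this forces mu to be nonincreasing, so mu lies in Gamma a.
    More importantly, it controls the lower level sets of nu: for each t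
    there is a cut p such that {nu <= t} lies beyond p and carries exactly
    the mass a_p + a_{p+1} + ... of mu ([tail_cuts]).

    That single property gives the minimality of nu for majorization, in the
    form: for every t, the sum of (t - nu_c) over {nu_c <= t} is at most the
    sum of the positive parts of t - y_i ([hinge_majorized]).
    - Against y = lam + g with g in Gamma a, the mass of g beyond p is at
      most the mass of a beyond p ([tail_cuts_majorized]).  The inequality of
      Karamata then makes mu a minimizer for each strictly convex f, and
      strict convexity at midpoints makes it the only one ([is_mu_least]).
    - Against the spectrum y of a completion, there are orthonormal vectors
      u_c, for c >= p, orthogonal to the first p added vectors
      g_0, ..., g_{p-1}, with u_c in the span of the first c + 1
      eigenvectors of the initial operator
      ([orthonormal_staircase]).  The quadratic form of the initial operator
      at u_c is at most lam_c, the vectors g_0, ..., g_{p-1} contribute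
      nothing, and the others contribute at most their squared norms in
      total, by the inequality of Bessel.  Comparing with the eigenvalues of
      the completed operator, again by Bessel, gives the bound
      ([staircase_bound]).

    Finally nu is attained ([optimal_spectrum_attained]): the Schur-Horn
    theorem ([schur_horn]) provides k vectors with squared norms a whose frame
    operator is diagonal with entries mu in an eigenbasis of the initial
    operator, with mu in decreasing order against lam in increasing order.

    Both Karamata's inequality and the Schur-Horn theorem are obtained from
    one induction principle on majorization ([pinching_ind]): a vector
    majorized by x is reached from x by finitely many transfers of mass from
    a larger entry to a smaller one. *)

(** * Prefix sums, sorting and transfers *)

Section PrefixSums.
Context {R : realType}.
Implicit Types m n p : nat.

(** Prefix sums in the given order; on nonincreasing vectors these are the
    partial sums that define majorization. *)
Definition psum {m} p (x : 'rV[R]_m) : R := \sum_(i < m | (i < p)%N) x 0 i.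

Definition entries {m} (x : 'rV[R]_m) : seq R := [seq x 0 i | i <- enum 'I_m].

Definition nonincreasing {m} (x : 'rV[R]_m) : Prop :=
  forall i j : 'I_m, (i <= j)%N -> x 0 j <= x 0 i.

Lemma size_entries {m} (x : 'rV[R]_m) : size (entries x) = m.
Proof. by rewrite size_map size_enum_ord. Qed.

Lemma nth_entries {m} (x : 'rV[R]_m) (i : 'I_m) : (entries x)`_i = x 0 i.
Proof. by rewrite (nth_map i) ?size_enum_ord // nth_ord_enum. Qed.

Lemma entries_row m (s : seq R) : size s = m -> entries (\row_(i < m) s`_i) = s.
Proof.
move=> sm; apply: (@eq_from_nth _ 0); first by rewrite size_entries.
move=> i; rewrite size_entries => im.
by rewrite (nth_entries _ (Ordinal im)) mxE.
Qed.

Lemma big_entries {m} (x : 'rV[R]_m) (h : R -> R) :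
  \sum_(z <- entries x) h z = \sum_i h (x 0 i).
Proof. by rewrite big_map big_enum. Qed.

Lemma perm_sort_decr {m} (x : 'rV[R]_m) : perm_eq (sort_decr x) (entries x).
Proof. by rewrite perm_sort. Qed.

Lemma size_sort_decr {m} (x : 'rV[R]_m) : size (sort_decr x) = m.
Proof. by rewrite (perm_size (perm_sort_decr x)) size_entries. Qed.

Lemma entries_decr {m} (x : 'rV[R]_m) : entries (decr x) = sort_decr x.
Proof. by rewrite /decr entries_row // size_sort_decr. Qed.

Lemma ge_total : total (fun u v : R => v <= u).
Proof. by move=> u v; apply: le_total. Qed.

Lemma ge_trans : transitive (fun u v : R => v <= u).
Proof. by move=> v u w uv vw; apply: le_trans vw uv. Qed.

Lemma ge_anti : antisymmetric (fun u v : R => v <= u).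
Proof. by move=> u v; rewrite andbC; apply: le_anti. Qed.

Lemma sort_ge_perm (s1 s2 : seq R) : perm_eq s1 s2 ->
  sort (fun u v => v <= u) s1 = sort (fun u v => v <= u) s2.
Proof. by move=> ?; apply/perm_sortP => //; [exact: ge_total|exact: ge_trans|exact: ge_anti]. Qed.

Lemma sort_decr_decr {m} (x : 'rV[R]_m) : sort_decr (decr x) = sort_decr x.
Proof.
rewrite {1}/sort_decr -/(entries _) entries_decr; apply: sort_ge_perm.
exact: perm_sort_decr.
Qed.

Lemma decr_nonincreasing {m} (x : 'rV[R]_m) : nonincreasing (decr x).
Proof.
move=> i j ij; rewrite !mxE.
have := sorted_leq_nth ge_trans (fun z => lexx z) 0 (sort_sorted ge_total (entries x)).
by apply=> //; rewrite inE size_sort_decr.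
Qed.

Lemma nonincreasing_decr {m} (x : 'rV[R]_m) : nonincreasing x -> x = decr x.
Proof.
move=> xd; have e : sort_decr x = entries x.
  apply: sorted_sort; first exact: ge_trans.
  rewrite sorted_pairwise; last exact: ge_trans.
  apply/(pairwiseP 0) => i j; rewrite !inE size_entries => im jm ij.
  rewrite (nth_entries x (Ordinal im)) (nth_entries x (Ordinal jm)).
  by apply: xd; apply: ltnW.
by apply/rowP => i; rewrite mxE e nth_entries.
Qed.

Lemma sum_nth_entries {m} (x : 'rV[R]_m) p :
  \sum_(i < p) (entries x)`_i = psum p x.
Proof.
transitivity (\sum_(i < p | (i < m)%N) (entries x)`_i).
  rewrite (bigID (fun i : 'I_p => (i < m)%N)) /= [X in _ + X]big1 ?addr0 //.
  by move=> i; rewrite -leqNgt => mi; rewrite nth_default ?size_entries.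
rewrite -(big_mkord (fun i => (i < m)%N) (fun i => (entries x)`_i)).
transitivity (\sum_(0 <= i < m | (i < p)%N) (entries x)`_i).
  rewrite [LHS](big_nat_widen _ _ (maxn p m)) ?leq_maxl //.
  rewrite [RHS](big_nat_widen _ _ (maxn p m)) ?leq_maxr //.
  by apply: eq_bigl => i; rewrite andbC.
by rewrite big_mkord; apply: eq_bigr => i _; rewrite nth_entries.
Qed.

Lemma sum_sort_decrE {m} (x : 'rV[R]_m) p :
  \sum_(i < p) (sort_decr x)`_i = psum p (decr x).
Proof. by rewrite -entries_decr sum_nth_entries. Qed.

Lemma sum_decr {m} (x : 'rV[R]_m) (h : R -> R) :
  \sum_i h (decr x 0 i) = \sum_i h (x 0 i).
Proof.
rewrite -!big_entries entries_decr; apply: perm_big; exact: perm_sort_decr.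
Qed.

Lemma tr_decr {m} (x : 'rV[R]_m) : tr (decr x) = tr x.
Proof. exact: (sum_decr x id). Qed.

Lemma majorizedE {m n} (x : 'rV[R]_m) (y : 'rV[R]_n) :
  x ≺ y <-> (forall p, psum p (decr x) <= psum p (decr y)) /\ tr x = tr y.
Proof.
by split=> -[h1 h2]; split=> // p; have := h1 p; rewrite !sum_sort_decrE.
Qed.

Lemma psum_ge {m} p (x : 'rV[R]_m) : (m <= p)%N -> psum p x = tr x.
Proof. by move=> mp; apply: eq_bigl => i; rewrite (leq_trans (ltn_ord i)). Qed.

Lemma trD {m} (x y : 'rV[R]_m) : tr (x + y) = tr x + tr y.
Proof. by rewrite /tr -big_split; apply: eq_bigr => i _; rewrite mxE. Qed.

Lemma psumD {m} p (x y : 'rV[R]_m) : psum p (x + y) = psum p x + psum p y.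
Proof. by rewrite /psum -big_split; apply: eq_bigr => i _; rewrite mxE. Qed.

Lemma psumZ {m} p c (x : 'rV[R]_m) : psum p (c *: x) = c * psum p x.
Proof. by rewrite /psum mulr_sumr; apply: eq_bigr => i _; rewrite mxE. Qed.

Lemma psum_tail {m} p (x : 'rV[R]_m) :
  tr x = psum p x + \sum_(i < m | (p <= i)%N) x 0 i.
Proof.
rewrite /tr (bigID (fun i : 'I_m => (i < p)%N)) /=; congr (_ + _).
by apply: eq_bigl => i; rewrite -leqNgt.
Qed.

(** A transfer with 0 <= e <= x_i - x_j is the T-transform of Hardy,
    Littlewood and Polya. *)
Definition transfer {m} (x : 'rV[R]_m) (i j : 'I_m) (e : R) : 'rV[R]_m :=
  x + e *: (delta_mx 0 j - delta_mx 0 i).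

Lemma transferE {m} (x : 'rV[R]_m) i j e l :
  transfer x i j e 0 l = x 0 l + e * ((l == j)%:R - (l == i)%:R).
Proof. by rewrite !mxE eqxx. Qed.

Lemma psum_transfer {m} p (x : 'rV[R]_m) i j e :
  psum p (transfer x i j e) = psum p x + e * ((j < p)%:R - (i < p)%:R).
Proof.
have D l : psum p (delta_mx 0 l : 'rV[R]_m) = (l < p)%:R.
  rewrite /psum; case: ltnP => lp.
    rewrite (bigD1 l) //= mxE !eqxx big1 ?addr0 // => q /andP[_ ql].
    by rewrite mxE (negbTE ql) andbF.
  rewrite big1 // => q qp; rewrite mxE; case: (altP (q =P l)) => [ql|].
    by move: qp; rewrite ql ltnNge lp.
  by rewrite andbF.
by rewrite psumD psumZ psumD -scaleN1r psumZ !D mulN1r.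
Qed.

Lemma tr_transfer {m} (x : 'rV[R]_m) i j e : tr (transfer x i j e) = tr x.
Proof.
by rewrite -!(@psum_ge m m) // psum_transfer !ltn_ord subrr mulr0 addr0.
Qed.

Lemma sum_transfer {m} (x : 'rV[R]_m) i j e (h : 'I_m -> R -> R) : i != j ->
  \sum_l h l (transfer x i j e 0 l) =
  \sum_l h l (x 0 l) + (h i (x 0 i - e) - h i (x 0 i))
    + (h j (x 0 j + e) - h j (x 0 j)).
Proof.
move=> ij; rewrite (bigD1 i) //= (bigD1 j) 1?eq_sym //=.
rewrite [X in _ = X + _ + _](bigD1 i) //= [X in _ = (_ + X) + _ + _](bigD1 j) 1?eq_sym //=.
rewrite !transferE !eqxx (negbTE ij) eq_sym (negbTE ij) mulr1n mulr0n.
rewrite (eq_bigr (fun l => h l (x 0 l))); last first.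
  move=> l /andP[/negbTE li /negbTE lj].
  by rewrite transferE li lj subrr mulr0 addr0.
by rewrite sub0r subr0 mulrN mulr1; ring.
Qed.

(** The target must be nonincreasing, but the source and the intermediate
    vectors need not be: only their prefix sums are tracked.  Each step
    transfers mass from an excess of the source over the target to the first
    deficit, which lies later; the amount is chosen so that one more
    coordinate agrees with the target. *)
Lemma pinching_ind {m} (P : 'rV[R]_m -> Prop) (a x : 'rV[R]_m) :
  (forall (z : 'rV[R]_m) i j e, i != j -> 0 <= e <= z 0 i - z 0 j -> P z ->
     P (transfer z i j e)) ->
  nonincreasing a -> (forall p, psum p a <= psum p x) -> tr x = tr a ->
  P x -> P a.
Proof.
move=> Ptr adecr; have [n] := ubnP #|[pred i | x 0 i != a 0 i]|.
elim: n => // n IH in x *; rewrite ltnS => nx le_ax tr_ax Px.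
have [->//|neq_ax] := eqVneq a x.
have sub0 : \sum_i (x 0 i - a 0 i) = 0.
  by rewrite sumrB -/(tr x) -/(tr a) tr_ax subrr.
have [l0 ltl0] : exists l, x 0 l < a 0 l.
  apply/existsP; apply: contraNT neq_ax; rewrite negb_exists => /forallP h.
  apply/eqP/rowP => i; apply/eqP; rewrite eq_sym -subr_eq0; apply/eqP.
  have ge0 j : true -> 0 <= x 0 j - a 0 j.
    by move=> _; rewrite subr_ge0 leNgt.
  exact: (psumr_eq0P ge0 sub0).
have [l ltl minl] := @arg_minnP _ l0 (fun l => x 0 l < a 0 l) (fun l : 'I_m => nat_of_ord l) ltl0.
(* Some excess precedes the first deficit, because the prefix sum of x - a up
   to l is nonnegative. *)
have [i /andP[il lti]] : exists i : 'I_m, (i < l)%N && (a 0 i < x 0 i).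
  apply/existsP; apply: contraLR ltl; rewrite negb_exists => /forallP h.
  rewrite -leNgt; have := le_ax l.+1; rewrite /psum.
  rewrite (bigD1 l) //= [X in _ <= X](bigD1 l) //=.
  suff : \sum_(i < m | (i < l.+1)%N && (i != l)) x 0 i
         <= \sum_(i < m | (i < l.+1)%N && (i != l)) a 0 i by lra.
  apply: ler_sum => i /andP[]; rewrite ltnS leq_eqVlt => /orP[/eqP il|il _].
    by rewrite -val_eqE /= il eqxx.
  by have := h i; rewrite il /= -leNgt.
have nil : i != l by rewrite -val_eqE /= ltn_eqF.
have ail : a 0 l <= a 0 i by apply: adecr; apply: ltnW.
pose e := Num.min (x 0 i - a 0 i) (a 0 l - x 0 l).
have e1 : e <= x 0 i - a 0 i by rewrite ge_min lexx.
have e2 : e <= a 0 l - x 0 l by rewrite ge_min lexx orbT.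
have e0 : 0 < e by rewrite lt_min !subr_gt0 lti ltl.
apply: (IH (transfer x i l e)); last 1 first.
- by apply: Ptr => //; rewrite (ltW e0) /=; lra.
- apply: leq_trans nx; apply: proper_card; apply/properP; split.
    apply/fintype.subsetP => q; rewrite !inE; apply: contraNneq => xa.
    rewrite transferE; case: (q =P i) => [qi|]; first by move: lti; rewrite -qi xa ltxx.
    case: (q =P l) => [ql|]; first by move: ltl; rewrite -ql xa ltxx.
    by rewrite subrr mulr0 addr0 xa.
  have [ee|ee] : e = x 0 i - a 0 i \/ e = a 0 l - x 0 l.
  + by rewrite /e; case: leP; [left|right].
  + exists i; rewrite !inE; first by rewrite gt_eqF.
    by rewrite transferE eqxx (negbTE nil) ee; apply/negPn/eqP => /=; ring.
  + exists l; rewrite !inE; first by rewrite lt_eqF.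
    by rewrite transferE eqxx (eq_sym l) (negbTE nil) ee; apply/negPn/eqP => /=; ring.
- (* Only prefixes containing i but not l lose e; all terms of x - a there are
     nonnegative, as l is the first deficit, so the surplus of such a prefix
     is at least that of i alone. *)
  move=> p; rewrite psum_transfer.
  case: (ltnP l p) => lp.
    by rewrite (ltn_trans il lp) subrr mulr0 addr0.
  case: (ltnP i p) => ip; last by rewrite subrr mulr0 addr0.
  suff : x 0 i - a 0 i <= psum p x - psum p a by rewrite mulr0n mulr1n; lra.
  rewrite /psum -sumrB (bigD1 i) //= lerDl sumr_ge0 // => q /andP[qp _].
  rewrite subr_ge0 leNgt; apply/negP => /minl.
  by rewrite leqNgt (leq_trans qp lp).
- by rewrite tr_transfer.
Qed.

End PrefixSums.

(** * Majorization, convex functions and hinge sums *)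

Section Convexity.
Context {R : realType}.

Lemma convex_pinch (f : R -> R) (x y e : R) : strictly_convex_nonneg f ->
  0 <= x -> 0 <= y -> 0 <= e <= x - y ->
  f (x - e) + f (y + e) <= f x + f y.
Proof.
move=> cf x0 y0 /andP[e0 exy].
have [->|en0] := eqVneq e 0; first by rewrite subr0 addr0.
have [ee|nee] := eqVneq e (x - y).
  by rewrite ee addrC (_ : x - (x - y) = y) 1?(_ : y + (x - y) = x); [|ring..].
have xy : 0 < x - y by lra.
pose t := e / (x - y).
have et : e = t * (x - y) by rewrite /t mulfVK // gt_eqF.
have t01 : 0 < t < 1.
  by rewrite /t divr_gt0 ?ltr_pdivrMr ?mul1r //= ?lt_neqAle ?nee // eq_sym en0.
have nxy : x != y by rewrite gt_eqF // -subr_gt0.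
have := cf x y t x0 y0 nxy t01.
have nyx : y != x by rewrite eq_sym.
have := cf y x t y0 x0 nyx t01.
rewrite (_ : (1 - t) * x + t * y = x - e); last by rewrite et; ring.
rewrite (_ : (1 - t) * y + t * x = y + e); last by rewrite et; ring.
by move: (f (x - e)) (f (y + e)) (f x) (f y) => *; nra.
Qed.

(** Transfers do not increase the sum of the values of a convex function. *)
Lemma karamata {m} (f : R -> R) (x y : 'rV[R]_m) : strictly_convex_nonneg f ->
  (forall i, 0 <= y 0 i) -> x ≺ y ->
  \sum_i f (x 0 i) <= \sum_i f (y 0 i).
Proof.
move=> cf y0 /majorizedE[le_xy tr_xy].
rewrite -(sum_decr x) -(sum_decr y).
pose P (z : 'rV[R]_m) := (forall i, 0 <= z 0 i) /\
  \sum_i f (z 0 i) <= \sum_i f (decr y 0 i).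
suff [] : P (decr x) by [].
apply: (@pinching_ind _ _ P _ (decr y)) => //; first last.
- split=> // i; have : decr y 0 i \in entries y.
    rewrite -(perm_mem (perm_sort_decr y)) -entries_decr.
    by apply/mapP; exists i; rewrite ?mem_enum.
  by case/mapP => j _ ->.
- by rewrite !tr_decr.
- exact: decr_nonincreasing.
move=> z i j e nij /[dup] /andP[e0 ez] ebnd [z0 fz]; split.
  move=> l; rewrite transferE.
  have := z0 l; have := z0 j; case: (l =P i) => [->|_]; case: eqP => _ /=; lra.
rewrite (@sum_transfer _ _ _ _ _ _ (fun=> f)) //.
by have := convex_pinch cf (z0 i) (z0 j) ebnd; lra.
Qed.

(** The sum of the m - p smallest entries of y is recovered from the hinge sum
    at the threshold t = y_p (in decreasing order), where the positive parts
    pick out exactly those entries; for x the same hinge sum bounds this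
    quantity from one side.  On the left the positive parts are written as a
    sum over a level set, the form in which the bounds on nu arise. *)
Lemma hinge_majorized {m} (x y : 'rV[R]_m) : tr x = tr y ->
  (forall t, \sum_(i | x 0 i <= t) (t - x 0 i)
             <= \sum_i Num.max 0 (t - y 0 i)) ->
  x ≺ y.
Proof.
move=> tr_xy hinge; apply/majorizedE; split=> // p.
have [mp|pm] := leqP m p; first by rewrite !psum_ge // !tr_decr tr_xy.
set t := decr y 0 (Ordinal pm).
have := psum_tail p (decr x); have := psum_tail p (decr y).
rewrite !tr_decr tr_xy => ey ex.
suff : \sum_(i < m | (p <= i)%N) (t - decr x 0 i) <=
       \sum_(i < m | (p <= i)%N) (t - decr y 0 i) by rewrite !sumrB; lra.
have hx : \sum_(i < m | (p <= i)%N) (t - decr x 0 i) <=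
          \sum_i Num.max 0 (t - decr x 0 i).
  rewrite [leRHS](bigID (fun i : 'I_m => (p <= i)%N)) /= -[leLHS]addr0.
  apply: lerD; last by apply: sumr_ge0 => i _; rewrite le_max lexx.
  by apply: ler_sum => i _; rewrite le_max lexx orbT.
have hy : \sum_i Num.max 0 (t - decr y 0 i)
          <= \sum_(i < m | (p <= i)%N) (t - decr y 0 i).
  rewrite [leLHS](bigID (fun i : 'I_m => (p <= i)%N)) /= -[leRHS]addr0.
  apply: lerD.
    apply: ler_sum => i pi; rewrite ge_max lexx andbT subr_ge0.
    exact: decr_nonincreasing.
  rewrite big1 // => i; rewrite -ltnNge => ip; apply/max_idPl.
  rewrite subr_le0; apply: decr_nonincreasing; exact: ltnW.
apply: (le_trans hx); apply: le_trans hy.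
rewrite (sum_decr x (fun z => Num.max 0 (t - z))).
rewrite (sum_decr y (fun z => Num.max 0 (t - z))).
apply: le_trans (hinge t); rewrite [leRHS]big_mkcond /=; apply: ler_sum => i _.
case: (leP (x 0 i) t) => h; first by rewrite ge_max lexx andbT subr_ge0.
by rewrite ge_max lexx subr_le0 (ltW h).
Qed.

End Convexity.

(** * The optimal vector on the polytope of prefix constraints *)

Section Polytope.
Context {R : realType}.
Local Open Scope classical_set_scope.
Local Open Scope ring_scope.

(** For nonincreasing a, this is [Gamma] without the requirement that g be
    nonincreasing, which leaves room to move mass between any two coordinates;
    the optimum turns out to be nonincreasing anyway. *)
Definition polytope {d k} (a : 'rV[R]_k) : set 'rV[R]_d :=
  [set g : 'rV[R]_d | [/\ forall i, 0 <= g 0 i, forall p, psum p a <= psum p g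
             & tr g = tr a]].

Lemma continuous_sum {T : topologicalType} {I : Type} (r : seq I) (P : pred I)
    (h : I -> T -> R) :
  (forall i, continuous (h i)) -> continuous (fun x => \sum_(i <- r | P i) h i x).
Proof.
move=> hc; elim: r => [|i r IH].
  rewrite (_ : (fun=> _) = cst 0); first exact: cst_continuous.
  by apply/funext => x; rewrite big_nil.
have -> : (fun x => \sum_(j <- i :: r | P j) h j x) =
   fun x => (if P i then h i x else 0) + \sum_(j <- r | P j) h j x.
  by apply/funext => x; rewrite big_cons; case: ifP; rewrite ?add0r.
move=> x; apply: cvgD; last exact: IH.
by case: (P i); [exact: hc|exact: cst_continuous].
Qed.

Lemma compact_polytope {d k} (a : 'rV[R]_k) : compact (@polytope d k a).
Proof.
have box : compact [set v : 'rV[R]_d | forall i, v ord0 i \in `[0, tr a]].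
  apply: (@rV_compact _ _ (fun=> `[0, tr a]%classic)).
  by move=> _; apply: segment_compact.
apply: (subclosed_compact _ box) => [|g [g0 _ trg] i]; last first.
  rewrite in_itv /= g0 -trg /tr (bigD1 i) //= lerDl.
  by apply: sumr_ge0 => j _.
have coord i : continuous (fun g : 'rV[R]_d => g 0 i).
  exact: coord_continuous.
have -> : @polytope d k a =
    ((\bigcap_(i in [set: 'I_d]) ((fun g : 'rV[R]_d => g 0 i) @^-1` [set x | 0 <= x]))
     `&` (\bigcap_(p in [set: nat]) (psum p @^-1` [set x | psum p a <= x])))
     `&` (tr @^-1` [set x | x = tr a]).
  apply/seteqP; split => [g [g0 gp gt]|g [[g0 gp] gt]].
    by split=> //; split=> // i _ /=; [exact: g0|exact: gp].
  by split=> // i; [exact: g0|exact: gp].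
apply: closedI; first apply: closedI.
- apply: closed_bigI => i _; apply: preimage_closed; last exact: closed_ge.
  by move=> g _; exact: coord.
- apply: closed_bigI => p _; apply: preimage_closed; last exact: closed_ge.
  by move=> g _; exact: continuous_sum.
- apply: preimage_closed; last exact: closed_eq.
  by move=> g _; exact: continuous_sum.
Qed.

Lemma polytope_neq0 {d k} (a : 'rV[R]_k) : (0 < d)%N -> (forall i, 0 <= a 0 i) ->
  @polytope d k a !=set0.
Proof.
(* Putting the whole mass in the first coordinate satisfies every prefix
   constraint. *)
case: d => // d _ a0; exists (tr a *: delta_mx 0 ord0).
have ple p : psum p a <= tr a.
  by rewrite (psum_tail p) lerDl sumr_ge0.
have ta : 0 <= tr a by apply: sumr_ge0.
have e p : psum p (tr a *: delta_mx 0 ord0 : 'rV[R]_d.+1) = tr a * (0 < p)%:R.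
  rewrite psumZ; congr (_ * _); rewrite /psum big_mkcond (bigD1 ord0) //= mxE !eqxx.
  rewrite big1 ?addr0 => [|i /negbTE i0]; first by case: (0 < p)%N.
  by rewrite mxE i0; case: ifP.
split=> [i|p|].
- by rewrite !mxE; case: (_ && _); rewrite ?mulr1 ?mulr0.
- rewrite e; case: p => [|p]; last by rewrite mulr1.
  by rewrite mulr0 /psum big1.
- by rewrite -(@psum_ge _ _ d.+1) // e mulr1.
Qed.

Lemma polytope_minimizer {d k} (a : 'rV[R]_k) (lam : 'rV[R]_d) :
  (0 < d)%N -> (forall i, 0 <= a 0 i) ->
  exists2 mu, polytope a mu & forall g, polytope a g ->
    \sum_i (lam 0 i + mu 0 i) ^+ 2 <= \sum_i (lam 0 i + g 0 i) ^+ 2.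
Proof.
move=> d0 a0.
have coordD i : continuous (fun g : 'rV[R]_d => lam 0 i + g 0 i).
  move=> g; have cg : (fun g : 'rV[R]_d => g 0 i) x @[x --> g] --> g 0 i.
    exact: coord_continuous.
  exact: (cvgD (cvg_cst (lam 0 i)) cg).
have cont : continuous (fun g : 'rV[R]_d => \sum_i (lam 0 i + g 0 i) ^+ 2).
  apply: continuous_sum => i g; exact: (cvgM (coordD i g) (coordD i g)).
have := EVT_min_rV (polytope_neq0 d0 a0) (@compact_polytope _ _ a).
case/(_ _ (continuous_subspaceT cont)) => mu; rewrite inE => muP mumin.
by exists mu => // g gP; apply: mumin; rewrite inE.
Qed.

Lemma pos_lower_bound {I : finType} (P : pred I) (f : I -> R) :
  (forall i, P i -> 0 < f i) -> exists2 e, 0 < e & forall i, P i -> e <= f i.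
Proof.
move=> f0; exists (\big[Num.min/1]_(i | P i) f i).
  by apply: (big_ind (fun x => 0 < x)) => // x y x0 y0; rewrite lt_min x0.
by move=> i Pi; apply: bigmin_le_cond.
Qed.

(** The first-order optimality condition for a separable convex objective on
    [polytope]: mass sits above a lower level only where a prefix constraint
    prevents it from moving down. *)
Definition tight_between {d k} (a : 'rV[R]_k) (lam mu : 'rV[R]_d) : Prop :=
  forall i j, lam 0 j + mu 0 j < lam 0 i + mu 0 i -> 0 < mu 0 i ->
    exists2 p : nat, (i < p <= j)%N & psum p mu = psum p a.

(** Otherwise all constraints that a transfer from i to j affects have some
    slack, and a small enough transfer stays feasible and decreases the sum of
    squares. *)
Lemma minimizer_exchange {d k} (a : 'rV[R]_k) (lam mu : 'rV[R]_d) :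
  polytope a mu ->
  (forall g, polytope a g ->
    \sum_i (lam 0 i + mu 0 i) ^+ 2 <= \sum_i (lam 0 i + g 0 i) ^+ 2) ->
  tight_between a lam mu.
Proof.
move=> [mu0 mup mut] mumin i j ji mui.
suff /existsP[p /andP[ip /eqP ep]] :
    [exists p : 'I_d.+1, (i < p <= j)%N && (psum p mu == psum p a)].
  by exists p.
apply: contraT; rewrite negb_exists => /forallP slack.
have [e1 e10 he1] : exists2 e, 0 < e &
    forall p : 'I_d.+1, (i < p <= j)%N -> e <= psum p mu - psum p a.
  apply: pos_lower_bound => p ip; have := slack p.
  by rewrite ip /= subr_gt0 lt_neqAle mup andbT eq_sym.
(* Half of the gap equalizes the two levels; every positive e up to that
   decreases the objective. *)
pose e := Num.min e1 (Num.min (mu 0 i) ((lam 0 i + mu 0 i - (lam 0 j + mu 0 j)) / 2)).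
have [ee1 emu egap] : [/\ e <= e1, e <= mu 0 i &
   e <= (lam 0 i + mu 0 i - (lam 0 j + mu 0 j)) / 2].
  by split; rewrite /e !ge_min lexx ?orbT.
have e0 : 0 < e by rewrite /e !lt_min e10 mui divr_gt0 ?subr_gt0.
have nij : i != j by apply: contraTneq ji => ->; rewrite ltxx.
have gP : polytope a (transfer mu i j e).
  split=> [l|p|]; last by rewrite tr_transfer.
    rewrite transferE; have := mu0 l.
    by case: (l =P i) => [->|_]; case: eqP => _ /=; lra.
  rewrite psum_transfer; have := mup p.
  case: (ltnP j p) => jp; case: (ltnP i p) => ip; rewrite ?mulr1n ?mulr0n; try lra.
  have pd : (p < d.+1)%N by rewrite ltnS ltnW // (leq_ltn_trans jp).
  by have := he1 (Ordinal pd); rewrite /= ip jp => /(_ isT); lra.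
have := mumin _ gP; rewrite (sum_transfer _ _ (fun l x => (lam 0 l + x) ^+ 2)) //.
by rewrite !expr2; nra.
Qed.

(** If mu_i < mu_j with i <= j, then the level at j exceeds the level at i
    because lam increases, but no prefix contains j and misses i. *)
Lemma minimizer_nonincreasing {d k} (a : 'rV[R]_k) (lam mu : 'rV[R]_d) :
  (forall i j : 'I_d, (i <= j)%N -> lam 0 i <= lam 0 j) ->
  polytope a mu ->
  tight_between a lam mu ->
  nonincreasing mu.
Proof.
move=> lami [mu0 _ _] exch i j ij; rewrite leNgt; apply/negP => lt_mu.
have [||p /andP[jp pi] _] := exch j i.
- by apply: ler_ltD => //; exact: lami.
- exact: le_lt_trans (mu0 i) lt_mu.
- by have := leq_ltn_trans ij (leq_trans jp pi); rewrite ltnn.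
Qed.

(** The consequence of optimality from which each comparison of lam + mu with
    another spectrum follows: on its lower level sets, mu has as little mass as
    the prefix constraints permit. *)
Definition tail_cuts {d k} (a : 'rV[R]_k) (lam mu : 'rV[R]_d) : Prop :=
  forall t : R, exists2 p : nat,
    forall c, lam 0 c + mu 0 c <= t -> (p <= c)%N &
    \sum_(c | lam 0 c + mu 0 c <= t) mu 0 c = \sum_(j < k | (p <= j)%N) a 0 j.

(** The cut is the last tight prefix that ends before the level set starts:
    mass beyond it and outside the level set would, by optimality, be separated
    from the start m of the level set by a later tight prefix. *)
Lemma tight_between_tail_cuts {d k} (a : 'rV[R]_k) (lam mu : 'rV[R]_d) :
  polytope a mu -> tight_between a lam mu -> tail_cuts a lam mu.
Proof.
move=> [mu0 mup mut] exch t.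
have [c0 c0t|none] := pickP (fun c => lam 0 c + mu 0 c <= t); last first.
  (* No coordinate has level at most t; the cut k leaves no entry of a either. *)
  exists k => [c|]; first by rewrite none.
  by rewrite big_pred0 // big_pred0 // => j; rewrite leqNgt ltn_ord.
have [m mt minm] := @arg_minnP _ c0 (fun c => lam 0 c + mu 0 c <= t)
  (fun c : 'I_d => nat_of_ord c) c0t.
have [||p /andP[pm /eqP ptight] pmax] :=
    @ex_maxnP (fun p => (p <= m)%N && (psum p mu == psum p a)) m.
- by exists 0; rewrite leq0n /psum !big_pred0 ?eqxx.
- by move=> p /andP[].
exists p => [c /minm|]; first exact: leq_trans.
have -> : \sum_(c | lam 0 c + mu 0 c <= t) mu 0 c = \sum_(c < d | (p <= c)%N) mu 0 c.
  rewrite big_mkcond [RHS]big_mkcond /=; apply: eq_bigr => c _.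
  case: ifPn => [/minm mc|]; first by rewrite (leq_trans pm mc).
  rewrite -ltNge => tc; case: ifP => // pc; apply/esym/eqP.
  rewrite eq_le mu0 andbT leNgt; apply/negP => mc0.
  have [q /andP[cq qm] qt] := exch c m (le_lt_trans mt tc) mc0.
  have := pmax q; rewrite qm qt eqxx => /(_ isT).
  by rewrite leqNgt (leq_ltn_trans pc cq).
by have := psum_tail p mu; have := psum_tail p a; rewrite mut ptight; lra.
Qed.

End Polytope.

(** * Minimality among sums with vectors of Gamma *)

Section Minimality.
Context {R : realType}.

Lemma GammaE {d k} (a : 'rV[R]_k) (g : 'rV[R]_d) : a = decr a ->
  Gamma a g <-> polytope a g /\ nonincreasing g.
Proof.
move=> ad; split.
  case=> g0 gd /majorizedE[mag tag]; split; last first.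
    by rewrite gd; exact: decr_nonincreasing.
  by split=> // p; rewrite ad gd.
move=> [[g0 gp gt] /nonincreasing_decr gd]; split=> //.
by apply/majorizedE; split=> // p; rewrite -ad -gd.
Qed.

(** Beyond the cut p, g has at most the mass of a, which is the mass that mu
    has on the level set; as the level set lies beyond p, g has no more mass
    there than mu. *)
Lemma tail_cuts_majorized {d k} (a : 'rV[R]_k) (lam mu g : 'rV[R]_d) :
  polytope a mu -> polytope a g -> tail_cuts a lam mu ->
  lam + mu ≺ lam + g.
Proof.
move=> [mu0 mup mut] [g0 gp gt] cuts.
apply: hinge_majorized => [|t]; first by rewrite !trD mut gt.
have [p pc sump] := cuts t.
under eq_bigl do rewrite mxE; under eq_bigr do rewrite mxE.
rewrite sumrB big_split /= sump.
have tail_le : \sum_(c | lam 0 c + mu 0 c <= t) g 0 c <= \sum_(j < k | (p <= j)%N) a 0 j.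
  have /= := psum_tail p a; have := psum_tail p g; rewrite gt => e1 e2.
  have := gp p; suff : \sum_(c | lam 0 c + mu 0 c <= t) g 0 c
    <= \sum_(i < d | (p <= i)%N) g 0 i by lra.
  rewrite big_mkcond [leRHS]big_mkcond; apply: ler_sum => c _.
  by case: ifP => [/pc ->//|_]; case: ifP.
apply: (@le_trans _ _ (\sum_(c | lam 0 c + mu 0 c <= t) (t - (lam 0 c + g 0 c)))).
  by rewrite sumrB big_split /=; lra.
rewrite [leLHS]big_mkcond /=; apply: ler_sum => c _; rewrite mxE.
by case: ifP => _; rewrite le_max lexx ?orbT.
Qed.

Lemma Gamma_midpoint {d k} (a : 'rV[R]_k) (g h : 'rV[R]_d) : a = decr a ->
  Gamma a g -> Gamma a h -> Gamma a (2^-1 *: (g + h)).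
Proof.
move=> ad /(GammaE _ ad)[[g0 gp gt] gd] /(GammaE _ ad)[[h0 hp ht] hd].
apply/(GammaE _ ad); split; first split=> [i|p|].
- by rewrite !mxE; have := g0 i; have := h0 i; lra.
- by rewrite psumZ psumD; have := gp p; have := hp p; lra.
- by rewrite -!(@psum_ge _ d d) // psumZ psumD !psum_ge // gt ht; lra.
- by move=> i j ij; rewrite !mxE; have := gd _ _ ij; have := hd _ _ ij; lra.
Qed.

(** A second minimizer would make the midpoint, which is still in [Gamma], beat
    the minimum by strict convexity in a coordinate where the two differ. *)
Lemma is_mu_least {d k} (a : 'rV[R]_k) (lam mu : 'rV[R]_d) (f : R -> R) :
  a = decr a -> (forall i, 0 <= lam 0 i) ->
  Gamma a mu -> (forall g, Gamma a g -> lam + mu ≺ lam + g) ->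
  strictly_convex_nonneg f -> is_mu f lam a mu.
Proof.
move=> ad lam0 muG least cf.
have nonneg g : Gamma a g -> forall i, 0 <= lam 0 i + g 0 i.
  by case=> g0 _ _ i; apply: addr_ge0.
have mumin g : Gamma a g ->
    \sum_i f (lam 0 i + mu 0 i) <= \sum_i f (lam 0 i + g 0 i).
  move=> gG; have h0 i : 0 <= (lam + g) 0 i by rewrite mxE; exact: nonneg.
  have := karamata cf h0 (least g gG).
  by under eq_bigr do rewrite mxE; under [leRHS]eq_bigr do rewrite mxE.
split=> // h [hG hmin]; apply/eqP; apply: contraT => neq.
have [i0 ni0] : exists i, mu 0 i != h 0 i.
  apply/existsP; apply: contraNT neq; rewrite negb_exists => /forallP e.
  by apply/eqP/rowP => i; apply/eqP; have := e i; rewrite negbK.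
have half i : lam 0 i + (2^-1 *: (mu + h)) 0 i =
    (1 - 2^-1) * (lam 0 i + mu 0 i) + 2^-1 * (lam 0 i + h 0 i).
  by rewrite !mxE; field.
have h01 : 0 < (2^-1 : R) < 1 by lra.
have lt i : mu 0 i != h 0 i ->
    f (lam 0 i + (2^-1 *: (mu + h)) 0 i) <
    (1 - 2^-1) * f (lam 0 i + mu 0 i) + 2^-1 * f (lam 0 i + h 0 i).
  move=> ni; rewrite half; apply: cf => //; try exact: nonneg.
  by apply: contraNneq ni => /addrI ->.
have le i : f (lam 0 i + (2^-1 *: (mu + h)) 0 i) <=
    (1 - 2^-1) * f (lam 0 i + mu 0 i) + 2^-1 * f (lam 0 i + h 0 i).
  have [e|/lt/ltW//] := eqVneq (mu 0 i) (h 0 i).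
  by rewrite half -e -!mulrDl addrNK !mul1r.
have := mumin _ (Gamma_midpoint ad muG hG); have := hmin _ muG.
suff : \sum_i f (lam 0 i + (2^-1 *: (mu + h)) 0 i) <
  (1 - 2^-1) * (\sum_i f (lam 0 i + mu 0 i)) + 2^-1 * \sum_i f (lam 0 i + h 0 i).
  by lra.
rewrite !mulr_sumr -big_split /= (bigD1 i0) //= [ltRHS](bigD1 i0) //=.
by apply: ltr_leD; [exact: lt|apply: ler_sum].
Qed.

Lemma exists_tail_cuts {d k} (a : 'rV[R]_k) (lam : 'rV[R]_d) : (0 < d)%N ->
  (forall i, 0 <= a 0 i) -> a = decr a ->
  (forall i j : 'I_d, (i <= j)%N -> lam 0 i <= lam 0 j) ->
  exists2 mu : 'rV[R]_d, Gamma a mu & tail_cuts a lam mu.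
Proof.
move=> d0 a0 ad lami.
have [mu muP mumin] := polytope_minimizer lam d0 a0.
have exch := minimizer_exchange muP mumin.
exists mu; last exact: tight_between_tail_cuts exch.
by apply/(GammaE _ ad); split=> //; exact: minimizer_nonincreasing exch.
Qed.

End Minimality.

(** * Orthonormal staircases and eigenvalue sums *)

Section Staircase.
Context {C : numClosedFieldType}.
Local Open Scope sesquilinear_scope.

Lemma singular_zero_col {F : fieldType} {d} (A : 'M[F]_d) (b : 'I_d) :
  (forall i, A i b = 0) -> exists2 v : 'rV[F]_d, v != 0 & v *m A = 0.
Proof.
move=> Ab; apply/det0P; rewrite (expand_det_col _ b) big1 // => i _.
by rewrite Ab mul0r.
Qed.

Lemma adjE {m n} (A : 'M[C]_(m, n)) i j : A^t* i j = (A j i)^*.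
Proof. by rewrite !mxE. Qed.

Lemma gram_diagE {m n} (A : 'M[C]_(m, n)) i :
  (A *m A^t*) i i = \sum_j `|A i j| ^+ 2.
Proof. by rewrite mxE; apply: eq_bigr => j _; rewrite adjE -normCK. Qed.

Lemma gram_colE {m n} (A : 'M[C]_(m, n)) j :
  \sum_i `|A i j| ^+ 2 = (A^t* *m A) j j.
Proof. by rewrite mxE; apply: eq_bigr => i _; rewrite adjE mulrC -normCK. Qed.

Lemma diag_formE {m n} (A : 'M[C]_(m, n)) (x : 'rV[C]_n) i :
  (A *m diag_mx x *m A^t*) i i = \sum_j x 0 j * `|A i j| ^+ 2.
Proof.
rewrite mxE; apply: eq_bigr => j _.
by rewrite mul_mx_diag mxE adjE normCK mulrAC mulrC.
Qed.

Lemma adjM {m n p} (A : 'M[C]_(m, n)) (B : 'M[C]_(n, p)) :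
  (A *m B)^t* = B^t* *m A^t*.
Proof. by rewrite trmx_mul map_mxM. Qed.

(** Row c of W (for c >= p) is supported on the first c + 1 coordinates and has
    to satisfy c linear conditions, given by the columns b < p of H and by
    orthogonality to the rows p, ..., c - 1.  Being one fewer than the
    unknowns, these have a nonzero solution, so the rows can be chosen one
    after the other; rows before p are set to zero to keep W square. *)
Lemma orthonormal_staircase {d} (H : 'M[C]_d) (p : nat) :
  exists W : 'M[C]_d,
  [/\ forall c i : 'I_d, (c < i)%N -> W c i = 0,
      forall c i : 'I_d, (c < p)%N -> W c i = 0,
      W *m W^t* = \matrix_(b, c) ((b == c) && (p <= c)%N)%:R
    & forall b c : 'I_d, (b < p <= c)%N -> (W *m H) c b = 0].
Proof.
suff /(_ d (leqnn d)) [W [W1 W2 W3 W4]] : forall n, (n <= d)%N ->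
  exists W : 'M[C]_d,
  [/\ forall c i : 'I_d, (c < i)%N -> W c i = 0,
      forall c i : 'I_d, ~~ (p <= c < n)%N -> W c i = 0,
      forall b c : 'I_d, (W *m W^t*) b c = ((b == c) && (p <= c < n)%N)%:R
    & forall b c : 'I_d, (b < p <= c)%N -> (W *m H) c b = 0].
  exists W; split=> //.
    by move=> c i cp; apply: W2; rewrite negb_and -ltnNge cp.
  by apply/matrixP => b c; rewrite W3 mxE ltn_ord andbT.
elim=> [|n IH] nd.
  exists 0; split=> [? ? _|? ? _|b c|b c _]; rewrite ?mul0mx ?mxE //.
  by rewrite ltn0 !andbF.
have [W [W1 W2 W3 W4]] := IH (ltnW nd).
have [np|pn] := ltnP n p.
  have pE c : (p <= c < n.+1)%N = (p <= c < n)%N.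
    by apply/idP/idP => /andP[pc]; rewrite ltnS ltnNge; move=> h;
       have := leq_trans np pc; [rewrite ltnNge h|move=> /ltnW; rewrite (negbTE h)].
  by exists W; split=> // *; rewrite ?pE // W2 // -pE.
pose N := Ordinal nd.
(* A square system for row n: its columns carry the p + (n - p) orthogonality
   conditions and, after column n, the vanishing of the later coordinates.
   Column n itself is free, so it is zero and the system is singular. *)
pose A : 'M[C]_d := \matrix_(i, b)
  if (b < p)%N then H i b else if (b < n)%N then (W b i)^* else
  if b == N then 0 else (i == b)%:R.
have [|v v0 vA] := @singular_zero_col _ _ A N.
  by move=> i; rewrite mxE /= ltnNge pn ltnn eqxx.
have vAb b : \sum_i v 0 i * A i b = 0 by have /matrixP/(_ 0 b) := vA; rewrite !mxE.
pose q := \sum_i `|v 0 i| ^+ 2.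
have q0 : 0 < q.
  rewrite lt0r sumr_ge0 ?andbT => [|i _]; last exact: exprn_ge0.
  apply: contraNneq v0 => /psumr_eq0P vi0; apply/eqP/rowP => i; rewrite mxE.
  apply/eqP; rewrite -normr_eq0 -sqrf_eq0; apply/eqP/vi0 => // j _.
  exact: exprn_ge0.
pose s := (sqrtC q)^-1.
have s0 : 0 <= s by rewrite invr_ge0 sqrtC_ge0 ltW.
have sq : s ^+ 2 * q = 1 by rewrite exprVn sqrtCK mulVf // gt_eqF.
pose W' : 'M[C]_d := \matrix_(c, i) if c == N then s * v 0 i else W c i.
have neqN (c : 'I_d) : c != N -> (p <= c < n.+1)%N = (p <= c < n)%N.
  by rewrite -val_eqE /= ltnS (leq_eqVlt c) => /negbTE ->.
have W'N i : W' N i = s * v 0 i by rewrite mxE eqxx.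
have W'neq c i : c != N -> W' c i = W c i by rewrite mxE => /negbTE ->.
have W3E b c : \sum_i W b i * (W c i)^* = ((b == c) && (p <= c < n)%N)%:R.
  by rewrite -W3 mxE; apply: eq_bigr => i _; rewrite adjE.
have dotN c : c != N -> \sum_i W' N i * (W' c i)^* = 0.
  move=> cN; have [pcn|npcn] := boolP (p <= c < n)%N; last first.
    by rewrite big1 // => i _; rewrite (W'neq c) // W2 // conjC0 mulr0.
  have := vAb c; under eq_bigr do rewrite mxE.
  case/andP: pcn => pc cn; rewrite ltnNge pc cn /= => e.
  rewrite -[RHS](mulr0 s) -[in RHS]e mulr_sumr; apply: eq_bigr => i _.
  by rewrite W'N W'neq // mulrA.
exists W'; split=> [c i ci|c i|b c|b c bpc].
- have [cN|cN] := eqVneq c N; last by rewrite W'neq // W1.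
  rewrite cN W'N; have := vAb i; rewrite cN /= in ci.
  rewrite (bigD1 i) //= big1 ?addr0 => [|j ji].
    rewrite mxE ltnNge (leq_trans pn (ltnW ci)) /= ltnNge (ltnW ci) /=.
    by rewrite -val_eqE /= gtn_eqF // eqxx mulr1 => ->; rewrite mulr0.
  rewrite mxE ltnNge (leq_trans pn (ltnW ci)) /= ltnNge (ltnW ci) /=.
  by rewrite -val_eqE /= gtn_eqF // (negbTE ji) mulr0.
- have [->|cN] := eqVneq c N; first by rewrite /= pn ltnSn.
  by rewrite neqN // => /W2 e; rewrite W'neq.
- transitivity (\sum_i W' b i * (W' c i)^*).
    by rewrite mxE; apply: eq_bigr => i _; rewrite adjE.
  have [->|bN] := eqVneq b N; have [->|cN] := eqVneq c N.
  + rewrite /= pn ltnSn -[RHS]sq /q mulr_sumr; apply: eq_bigr => i _.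
    by rewrite W'N -normCK normrM exprMn ger0_norm.
  + by rewrite dotN // eq_sym (negbTE cN).
  + rewrite (negbTE bN) /=; apply: (can_inj (@conjCK C)).
    rewrite conjC0 rmorph_sum -[RHS](dotN _ bN); apply: eq_bigr => i _.
    by rewrite rmorphM /= conjCK mulrC.
  + by rewrite neqN // -W3E; apply: eq_bigr => i _; rewrite !W'neq.
- have [cN|cN] := eqVneq c N.
    have := vAb b; case/andP: bpc => bp _.
    under eq_bigr do rewrite mxE bp.
    move=> e; rewrite cN mxE -[RHS](mulr0 s) -[in RHS]e mulr_sumr.
    by apply: eq_bigr => i _; rewrite W'N mulrA.
  by rewrite -(W4 _ _ bpc) !mxE; apply: eq_bigr => i _; rewrite W'neq.
Qed.

Definition partial_isometry {m n} (W : 'M[C]_(m, n)) := W *m W^t* *m W = W.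

(** The matrix 1 - W^* W is an orthogonal projection, so the squared norm of
    the image of a column under it, which is nonnegative, is the difference of
    the two sides. *)
Lemma bessel {m n k} (W : 'M[C]_(m, n)) (X : 'M[C]_(n, k)) j :
  partial_isometry W ->
  \sum_c `|(W *m X) c j| ^+ 2 <= \sum_i `|X i j| ^+ 2.
Proof.
move=> Wiso.
pose Y := X - W^t* *m (W *m X).
have : 0 <= \sum_i `|Y i j| ^+ 2 by apply: sumr_ge0 => i _; exact: exprn_ge0.
rewrite !gram_colE.
have -> : Y^t* *m Y = X^t* *m X - (W *m X)^t* *m (W *m X).
  have Yt : Y^t* = X^t* - (W *m X)^t* *m W.
    by rewrite /Y linearB /= map_mxB /= adjM trmxCK.
  rewrite Yt /Y mulmxBl !mulmxBr.
  have -> : (W *m X)^t* *m W *m (W^t* *m (W *m X)) = (W *m X)^t* *m (W *m X).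
    by rewrite -[LHS]mulmxA (mulmxA W) (mulmxA (W *m _)) [W *m _ *m W]Wiso.
  by rewrite adjM !mulmxA subrr subr0.
by rewrite [leRHS]mxE [X in _ + X]mxE subr_ge0.
Qed.

Lemma partial_isometryP {m n} (W : 'M[C]_(m, n)) (P : pred 'I_m) :
  W *m W^t* = \matrix_(b, c) ((b == c) && P c)%:R ->
  (forall c i, ~~ P c -> W c i = 0) -> partial_isometry W.
Proof.
move=> WW W0; apply/matrixP => c i; rewrite WW mxE (bigD1 c) //= big1 => [|b bc].
  rewrite mxE eqxx addr0; case: (boolP (P c)) => [_|/W0 ->]; last by rewrite mulr0.
  by rewrite mul1r.
by rewrite mxE eq_sym (negbTE bc) mul0r.
Qed.

(** In the spirit of Ky Fan's minimum principle, the right-hand side is an upper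
    bound of the sum of the t - <S u_c, u_c> over any orthonormal family, S
    being the operator with eigenvalues x.  The family used is the staircase
    in the eigenbasis V of the first summand, made orthogonal to the first p
    columns of G: there <S u_c, u_c> is at most lam_c plus the contribution of
    the remaining columns of G, whose total is at most their squared norms. *)
Lemma staircase_bound {d k} (V U : 'M[C]_d) (G : 'M[C]_(d, k)) (lam x h : 'rV[C]_d)
    (t : C) (p : nat) (P : pred 'I_d) :
  (d <= k)%N -> V \is unitarymx -> U \is unitarymx ->
  V^t* *m diag_mx lam *m V + G *m G^t* = U^t* *m diag_mx x *m U ->
  (forall i j : 'I_d, (i <= j)%N -> lam 0 i <= lam 0 j) ->
  (forall i, 0 <= h 0 i) -> (forall i, t - x 0 i <= h 0 i) ->
  (forall c, P c -> (p <= c)%N) ->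
  \sum_(c | P c) (t - lam 0 c) - \sum_(j < k | (p <= j)%N) \sum_i `|G i j| ^+ 2
  <= \sum_i h 0 i.
Proof.
move=> dk /unitarymxP Vu Uu SE lami h0 hx Pp.
(* Only columns before p <= c < d of G matter, so truncating it to d columns
   loses nothing. *)
pose H : 'M[C]_d := \matrix_(i, b) (V *m G) i (widen_ord dk b).
have [W [Wtri W0 WW WH]] := orthonormal_staircase H p.
have Wiso : partial_isometry W.
  apply: partial_isometryP WW _ => c i; rewrite -ltnNge; exact: W0.
pose Y := W *m V.
have YY : Y *m Y^t* = W *m W^t*.
  by rewrite adjM mulmxA -(mulmxA W) Vu mulmx1.
have Yiso : partial_isometry Y by rewrite /partial_isometry YY /Y mulmxA Wiso.
pose Z := Y *m U^t*.
have ZZ : Z *m Z^t* = W *m W^t*.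
  rewrite adjM trmxCK mulmxA -(mulmxA Y).
  have -> : U^t* *m U = 1%:M by apply/mulmx1C/unitarymxP.
  by rewrite mulmx1 YY.
have Ziso : partial_isometry Z by rewrite /partial_isometry ZZ -YY /Z mulmxA Yiso.
have norm1 c : P c -> (W *m W^t*) c c = 1 by move=> /Pp pc; rewrite WW mxE eqxx pc.
(* Both sides are the quadratic form of the full operator at row c of Y. *)
have formE c : \sum_i lam 0 i * `|W c i| ^+ 2 + \sum_j `|(Y *m G) c j| ^+ 2
             = \sum_i x 0 i * `|Z c i| ^+ 2.
  rewrite -!diag_formE -gram_diagE.
  transitivity ((W *m diag_mx lam *m W^t* + Y *m G *m (Y *m G)^t*) c c).
    by rewrite [RHS]mxE.
  congr ((_ : 'M__) c c).
  have -> : W *m diag_mx lam *m W^t* = Y *m (V^t* *m diag_mx lam *m V) *m Y^t*.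
    by rewrite (adjM W V) !mulmxA -(mulmxA W V) Vu mulmx1 -(mulmxA _ V) Vu mulmx1.
  have -> : Z *m diag_mx x *m Z^t* = Y *m (U^t* *m diag_mx x *m U) *m Y^t*.
    by rewrite (adjM Y) trmxCK !mulmxA.
  have -> : Y *m G *m (Y *m G)^t* = Y *m (G *m G^t*) *m Y^t*.
    by rewrite (adjM Y G) !mulmxA.
  by rewrite -mulmxDl -mulmxDr SE.
have quad_le c : P c -> \sum_i lam 0 i * `|W c i| ^+ 2 <= lam 0 c.
  move=> Pc; rewrite -[leRHS]mulr1 -(norm1 c Pc) gram_diagE mulr_sumr.
  apply: ler_sum => i _; have [ci|ic] := ltnP c i.
    by rewrite Wtri // normr0 expr0n !mulr0.
  by apply: ler_wpM2r; [exact: exprn_ge0|exact: lami].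
have shift_le c : P c -> t - \sum_i x 0 i * `|Z c i| ^+ 2
    <= \sum_i h 0 i * `|Z c i| ^+ 2.
  move=> Pc; rewrite -[X in X - _]mulr1 -(norm1 c Pc) -ZZ gram_diagE mulr_sumr.
  rewrite -sumrB; apply: ler_sum => i _; rewrite -mulrBl.
  by apply: ler_wpM2r; [exact: exprn_ge0|exact: hx].
have frame_le : \sum_(c | P c) \sum_j `|(Y *m G) c j| ^+ 2
    <= \sum_(j < k | (p <= j)%N) \sum_i `|G i j| ^+ 2.
  rewrite exchange_big [leRHS]big_mkcond /=; apply: ler_sum => j _.
  case: leqP => pj.
    apply: le_trans (bessel G j Yiso); rewrite big_mkcond; apply: ler_sum => c _.
    by case: ifP => // _; exact: exprn_ge0.
  rewrite big1 // => c /Pp pc.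
  have jd : (j < d)%N := leq_trans pj (leq_trans pc (ltnW (ltn_ord c))).
  have := WH (Ordinal jd) c; rewrite /= pj pc => /(_ isT).
  have -> : (W *m H) c (Ordinal jd) = (Y *m G) c j.
    rewrite -mulmxA !mxE; apply: eq_bigr => i _; congr (_ * _).
    by rewrite mxE; congr ((V *m G) i _); apply: val_inj.
  by move=> ->; rewrite normr0 expr0n.
have hinge_le : \sum_(c | P c) \sum_i h 0 i * `|Z c i| ^+ 2 <= \sum_i h 0 i.
  rewrite exchange_big /=; apply: ler_sum => i _; rewrite -mulr_sumr.
  rewrite -[leRHS]mulr1; apply: ler_wpM2l => //.
  have := bessel (1%:M : 'M[C]_d) i Ziso; rewrite mulmx1.
  rewrite [leRHS](bigD1 i) //= [X in _ + X]big1 => [|l li]; last first.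
    by rewrite mxE (negbTE li) normr0 expr0n.
  rewrite mxE eqxx normr1 expr1n addr0; apply: le_trans.
  rewrite big_mkcond; apply: ler_sum => c _.
  by case: ifP => // _; exact: exprn_ge0.
apply: le_trans hinge_le; rewrite lerBlDr.
apply: (@le_trans _ _ (\sum_(c | P c) \sum_i h 0 i * `|Z c i| ^+ 2
    + \sum_(c | P c) \sum_j `|(Y *m G) c j| ^+ 2)); last by rewrite lerD2l.
rewrite -big_split /=; apply: ler_sum => c Pc; rewrite lerBlDr.
apply: le_trans (_ : _ <= \sum_i h 0 i * `|Z c i| ^+ 2
   + \sum_i x 0 i * `|Z c i| ^+ 2) _; first by rewrite -lerBlDr shift_le.
by rewrite -formE -[leRHS]addrA lerD2l [leLHS]addrC lerD2l quad_le.
Qed.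

End Staircase.

(** * The Schur-Horn theorem *)

Section Rotation.
Context {C : numClosedFieldType}.
Local Open Scope sesquilinear_scope.

(** Multiplying one of two vectors by this phase makes their inner product z
    purely imaginary. *)
Lemma orthogonal_phase (z : C) :
  exists2 w : C, w * w^* = 1 & w^* * z + w * z^* = 0.
Proof.
have [->|z0] := eqVneq z 0.
  by exists 1; rewrite ?conjC1 ?conjC0 ?mulr1 // !mulr0 addr0.
have n0 : `|z| != 0 by rewrite normr_eq0.
have nr : `|z|^* = `|z| by rewrite geC0_conj.
exists ('i * (z / `|z|)).
  rewrite -normCK !normrM normCi normfV normr_id mulfV //.
  by rewrite mulr1 expr1n.
rewrite !rmorphM /= fmorphV /= conjCi nr.
by ring.
Qed.

(** Rotating two columns is right multiplication by a unitary matrix, which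
    keeps X X^*; with the phase that makes the two columns orthogonal in the
    real sense, the cross terms disappear and the squared norms mix with
    weights c^2 and s^2. *)
Lemma column_rotation {d k} (X : 'M[C]_(d, k)) (i j : 'I_k) (c s : C) :
  i != j -> c^* = c -> s^* = s -> c ^+ 2 + s ^+ 2 = 1 ->
  exists X' : 'M[C]_(d, k),
  [/\ X' *m X'^t* = X *m X^t*,
      \sum_l `|X' l i| ^+ 2 =
        c ^+ 2 * (\sum_l `|X l i| ^+ 2) + s ^+ 2 * (\sum_l `|X l j| ^+ 2),
      \sum_l `|X' l j| ^+ 2 =
        s ^+ 2 * (\sum_l `|X l i| ^+ 2) + c ^+ 2 * (\sum_l `|X l j| ^+ 2)
    & forall m, m != i -> m != j -> forall l, X' l m = X l m].
Proof.
move=> nij cr sr cs1.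
have [w ww wz] := orthogonal_phase (\sum_l X l i * (X l j)^*).
have ji : j != i by rewrite eq_sym.
pose X' : 'M[C]_(d, k) := \matrix_(l, m)
  if m == i then c * X l i + s * w * X l j else
  if m == j then c * X l j - s * w^* * X l i else X l m.
have X'i l : X' l i = c * X l i + s * w * X l j by rewrite mxE eqxx.
have X'j l : X' l j = c * X l j - s * w^* * X l i.
  by rewrite mxE (negbTE ji) eqxx.
have cX'i l : (X' l i)^* = c * (X l i)^* + s * w^* * (X l j)^*.
  by rewrite X'i rmorphD !rmorphM /= cr sr.
have cX'j l : (X' l j)^* = c * (X l j)^* - s * w * (X l i)^*.
  by rewrite X'j rmorphB !rmorphM /= cr sr conjCK.
have X'm m l : m != i -> m != j -> X' l m = X l m.
  by move=> mi mj; rewrite mxE (negbTE mi) (negbTE mj).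
have cross : \sum_l (w^* * (X l i * (X l j)^*) + w * (X l j * (X l i)^*)) = 0.
  rewrite -[RHS]wz rmorph_sum !mulr_sumr -big_split; apply: eq_bigr => l _ /=.
  by rewrite rmorphM /= conjCK [X in _ + w * X]mulrC.
exists X'; split=> [|||m mi mj l]; last exact: X'm.
- apply/matrixP => p q; rewrite !mxE.
  rewrite (bigD1 i) //= (bigD1 j) //= [RHS](bigD1 i) //= [X in _ = _ + X](bigD1 j) //=.
  rewrite !addrA; congr (_ + _); last first.
    by apply: eq_bigr => m /andP[mi mj]; rewrite !adjE !X'm.
  rewrite !adjE !cX'i !cX'j !X'i !X'j.
  move: (X p i) (X p j) (X q i)^* (X q j)^* => x y u v.
  transitivity ((c ^+ 2 + s ^+ 2 * (w * w^*)) * (x * u + y * v)); first by ring.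
  by rewrite ww mulr1 cs1 mul1r.
- rewrite -[RHS]addr0 -[X in _ = _ + X](mulr0 (c * s)) -[X in _ = _ + _ * X]cross !mulr_sumr.
  rewrite -!big_split; apply: eq_bigr => l _ /=.
  rewrite !normCK cX'i X'i.
  move: (X l i) (X l j) => x y.
  transitivity (c ^+ 2 * (x * x^*) + s ^+ 2 * ((w * w^*) * (y * y^*))
     + c * s * (w^* * (x * y^*) + w * (y * x^*))); first by ring.
  by rewrite ww mul1r.
- rewrite -[RHS]addr0 -[X in _ = _ + X](mulr0 (- (c * s))) -[X in _ = _ + _ * X]cross !mulr_sumr.
  rewrite -!big_split; apply: eq_bigr => l _ /=.
  rewrite !normCK cX'j X'j.
  move: (X l i) (X l j) => x y.
  transitivity (s ^+ 2 * ((w * w^*) * (x * x^*)) + c ^+ 2 * (y * y^*)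
     + - (c * s) * (w^* * (x * y^*) + w * (y * x^*))); first by ring.
  by rewrite ww mul1r.
Qed.

End Rotation.

Section SchurHorn.
Context {R : realType}.
Local Notation C := R[i].
Local Open Scope complex_scope.
Local Open Scope sesquilinear_scope.

(** For the squared norms mu padded by zeros, the columns sqrt(mu_j) e_j do; a
    transfer of squared norm between two columns is realized by a rotation. *)
Lemma schur_horn {d k} (a : 'rV[R]_k) (mu : 'rV[R]_d) : (d <= k)%N ->
  nonincreasing a -> (forall i, 0 <= mu 0 i) ->
  (forall p, psum p a <= psum p mu) -> tr mu = tr a ->
  exists X : 'M[C]_(d, k),
    X *m X^t* = diag_mx (map_mx (real_complex R) mu) /\
    forall j, \sum_i `|X i j| ^+ 2 = (a 0 j)%:C.
Proof.
move=> dk ad mu0 le_amu tr_mu.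
pose P (z : 'rV[R]_k) := exists X : 'M[C]_(d, k),
    X *m X^t* = diag_mx (map_mx (real_complex R) mu) /\
    forall j, \sum_i `|X i j| ^+ 2 = (z 0 j)%:C.
pose mu' : 'rV[R]_k := \row_j (if insub (j : nat) is Some i then mu 0 i else 0).
have mu'E (j : 'I_k) (jd : (j < d)%N) : mu' 0 j = mu 0 (Ordinal jd).
  by rewrite mxE insubT.
have mu'0 (j : 'I_k) : (d <= j)%N -> mu' 0 j = 0.
  by move=> dj; rewrite mxE insubF // ltnNge dj.
have psum_mu' p : psum p mu' = psum p mu.
  rewrite -!sum_nth_entries; apply: eq_bigr => i _.
  have [ik|ki] := ltnP i k; last first.
    by rewrite !nth_default ?size_entries // (leq_trans dk).
  rewrite (nth_entries _ (Ordinal ik)); have [id|di] := ltnP i d.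
    by rewrite (nth_entries _ (Ordinal id)) mu'E.
  by rewrite mu'0 // nth_default ?size_entries.
apply: (@pinching_ind _ _ P a mu').
- move=> z i j e nij /andP[e0 ez] [X [XX Xn]].
  have [zij|nz] := eqVneq (z 0 i) (z 0 j).
    have -> : e = 0 by apply/eqP; rewrite eq_le e0 andbT; move: ez; rewrite zij subrr.
    by exists X; split=> // l; rewrite Xn transferE mul0r addr0.
  have gap : 0 < z 0 i - z 0 j.
    by rewrite lt_neqAle (le_trans e0 ez) andbT eq_sym subr_eq0.
  pose q := e / (z 0 i - z 0 j).
  have qe : q * (z 0 i - z 0 j) = e by rewrite /q mulfVK // gt_eqF.
  have q0 : 0 <= q by rewrite divr_ge0 // ltW.
  have q1 : 0 <= 1 - q by rewrite subr_ge0 ler_pdivrMr // mul1r.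
  have [|||X' [X'X' X'i X'j X'm]] :=
    @column_rotation _ _ _ X i j (Num.sqrt (1 - q))%:C (Num.sqrt q)%:C nij _ _ _.
  + exact: conjc_real.
  + exact: conjc_real.
  + by rewrite -!rmorphXn -rmorphD /= !sqr_sqrtr // subrK.
  exists X'; split=> [|l]; first by rewrite X'X'.
  have [->|li] := eqVneq l i.
    rewrite X'i !Xn -!rmorphXn -!rmorphM -rmorphD /= !sqr_sqrtr // transferE.
    by rewrite eqxx (negbTE nij) -[in RHS]qe; congr _%:C => /=; ring.
  have [->|lj] := eqVneq l j.
    rewrite X'j !Xn -!rmorphXn -!rmorphM -rmorphD /= !sqr_sqrtr // transferE.
    by rewrite eqxx eq_sym (negbTE nij) -[in RHS]qe; congr _%:C => /=; ring.
  rewrite transferE (negbTE li) (negbTE lj) subrr mulr0 addr0 -Xn.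
  by apply: eq_bigr => m _; rewrite X'm.
- exact: ad.
- by move=> p; rewrite psum_mu'.
- by rewrite -(@psum_ge _ _ k) // psum_mu' psum_ge.
- exists (\matrix_(i, j) (if (i : nat) == j then (Num.sqrt (mu 0 i))%:C else 0)).
  have sqE i : (Num.sqrt (mu 0 i))%:C * (Num.sqrt (mu 0 i))%:C = (mu 0 i)%:C :> C.
    by rewrite -rmorphM -expr2 sqr_sqrtr.
  split.
    apply/matrixP => p q; rewrite !mxE (bigD1 (widen_ord dk p)) //= big1 ?addr0.
      rewrite adjE !mxE /= eqxx eq_sym; case: (p =P q) => [->|/eqP npq].
        by rewrite eqxx [X in _ * X]conjc_real sqE.
      by rewrite val_eqE (negbTE npq) conjC0 mulr0.
    move=> j; rewrite -val_eqE /= => jp; rewrite mxE eq_sym (negbTE jp).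
    by rewrite mul0r.
  move=> j; have [jd|dj] := ltnP j d.
    rewrite (mu'E _ jd) (bigD1 (Ordinal jd)) //= big1 ?addr0 => [|i].
      by rewrite mxE eqxx normCK [X in _ * X]conjc_real sqE.
    by rewrite -val_eqE /= => ij; rewrite mxE (negbTE ij) normr0 expr0n.
  rewrite mu'0 // big1 // => i _; rewrite mxE ltn_eqF ?normr0 ?expr0n //.
  exact: leq_trans dj.
Qed.

End SchurHorn.

(** * Spectra of completions *)

Section Completions.
Context {R : realType}.
Local Notation C := R[i].
Local Open Scope complex_scope.
Local Open Scope sesquilinear_scope.

Local Notation rdiag x := (diag_mx (map_mx (real_complex R) x)).

Lemma hermitian_diagonalization {d} (S : 'M[C]_d) : S^t* = S ->
  exists2 U : 'M[C]_d, U \is unitarymx &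
    exists x : 'rV[R]_d, S = U^t* *m rdiag x *m U.
Proof.
move=> Sh; have herm : S \is hermsymmx.
  by apply/is_hermitianmxP; rewrite expr0 scale1r Sh.
have /mxOverP real := hermitian_spectral_diag_real herm.
have /orthomx_spectralP := hermitian_normalmx herm.
have Uu := spectral_unitarymx S; rewrite invmx_unitary // => Seq.
exists (spectralmx S) => //; exists (\row_i complex.Re (spectral_diag S 0 i)).
rewrite {1}Seq; congr (_ *m diag_mx _ *m _); apply/rowP => i; rewrite !mxE.
by rewrite [RHS]RRe_real // real.
Qed.

Lemma char_poly_unitary_conj {d} (U D : 'M[C]_d) : U \is unitarymx ->
  char_poly (U^t* *m D *m U) = char_poly D.
Proof.
move=> /unitarymxP UU; have UU' : U^t* *m U = 1%:M by apply: mulmx1C.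
rewrite /char_poly.
have -> : char_poly_mx (U^t* *m D *m U) =
    map_mx polyC (U^t*) *m char_poly_mx D *m map_mx polyC U.
  rewrite /char_poly_mx !map_mxM mulmxBr mulmxBl; congr (_ - _).
  by rewrite mul_mx_scalar -scalemxAl -map_mxM UU' map_mx1 scalemx1.
by rewrite !det_mulmx mulrAC -det_mulmx -map_mxM UU' map_mx1 det1 mul1r.
Qed.

Lemma char_roots_diag {d} (U : 'M[C]_d) (x : 'rV[R]_d) : U \is unitarymx ->
  perm_eq [seq complex.Re z | z <- char_roots (U^t* *m rdiag x *m U)] (entries x).
Proof.
move=> Uu; set S := _ *m U; rewrite /char_roots.
case: closed_field_poly_normal => r /= er.
have -> : entries x = [seq complex.Re z | z <- [seq z%:C | z <- entries x]].
  by rewrite -map_comp map_id_in.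
apply: perm_map; apply: prod_XsubC_eq.
move: er; rewrite (monicP (char_poly_monic S)) scale1r => <-.
rewrite char_poly_unitary_conj // char_poly_trig ?diag_mx_is_trig //.
rewrite big_map /entries big_map big_enum; apply: eq_bigr => i _.
by rewrite !mxE eqxx.
Qed.

Lemma eig_decr_diag {d} (U : 'M[C]_d) (x : 'rV[R]_d) : U \is unitarymx ->
  eig_decr (U^t* *m rdiag x *m U) = decr x.
Proof.
by move=> /(char_roots_diag x)/sort_ge_perm e; apply/rowP => i; rewrite !mxE e.
Qed.

(** Besides diagonalizing, this orders the eigenbasis along the increasing
    spectrum, which the staircase needs. *)
Lemma eig_incr_diagonalization {d} (S : 'M[C]_d) : S^t* = S ->
  (forall i j : 'I_d, (i <= j)%N -> eig_incr S 0 i <= eig_incr S 0 j) /\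
  exists2 V : 'M[C]_d, V \is unitarymx & S = V^t* *m rdiag (eig_incr S) *m V.
Proof.
move=> /hermitian_diagonalization[U Uu [x Sx]].
pose s := sort (fun u v : R => u <= v) [seq complex.Re z | z <- char_roots S].
have s_perm : perm_eq s (entries x).
  by rewrite perm_sort Sx; exact: char_roots_diag.
have size_s : size s = d by rewrite (perm_size s_perm) size_entries.
split=> [i j ij|].
  rewrite !mxE; have := sorted_leq_nth (@le_trans _ R) (@lexx _ R) 0 (sort_sorted (@le_total _ R) [seq complex.Re z | z <- char_roots S]).
  by apply=> //; rewrite inE size_s.
have size_x : size (entries x) == d by rewrite size_entries.
have /tuple_permP[p sp] : perm_eq s (Tuple size_x) by [].
have eigE i : eig_incr S 0 i = x 0 (p i).
  by rewrite mxE -/s sp (nth_map i) ?size_enum_ord // nth_ord_enum (tnth_nth 0) nth_entries.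
move: (eig_incr S) eigE => lam lamE; exists (row_perm p U).
  apply/unitarymxP/matrixP => i j; have /unitarymxP/matrixP/(_ (p i) (p j)) := Uu.
  rewrite !mxE (inj_eq perm_inj) => <-; apply: eq_bigr => l _.
  by rewrite !mxE.
apply/matrixP => i j; rewrite {1}Sx !mxE (reindex_inj (@perm_inj _ p)) /=.
by apply: eq_bigr => l _; rewrite !mul_mx_diag !mxE lamE.
Qed.

(** The synthesis operator of the sequence, with the vectors as columns; the
    frame operator is its product with its adjoint. *)
Definition synthesis {d k} (G : k.-tuple 'cV[C]_d) : 'M[C]_(d, k) :=
  \matrix_(i, j) tnth G j i 0.

Lemma frame_op_synthesis {d k} (G : k.-tuple 'cV[C]_d) :
  frame_op G = synthesis G *m (synthesis G)^t*.
Proof.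
apply/matrixP => p q; rewrite /frame_op big_tuple summxE mxE; apply: eq_bigr => j _.
by rewrite !mxE big_ord1 !mxE.
Qed.

Lemma frame_op_cat {d} (F G : seq 'cV[C]_d) :
  frame_op (F ++ G) = frame_op F + frame_op G.
Proof. exact: big_cat. Qed.

Lemma frame_op_adj {d k} (G : k.-tuple 'cV[C]_d) : (frame_op G)^t* = frame_op G.
Proof. by rewrite frame_op_synthesis adjM trmxCK. Qed.

Lemma trace_synthesis {d k} (X : 'M[C]_(d, k)) :
  \tr (X *m X^t*) = \sum_j \sum_i `|X i j| ^+ 2.
Proof.
by rewrite exchange_big; apply: eq_bigr => i _; exact: gram_diagE.
Qed.

Lemma trace_rdiag {d} (U : 'M[C]_d) (x : 'rV[R]_d) : U \is unitarymx ->
  \tr (U^t* *m rdiag x *m U) = (tr x)%:C.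
Proof.
move=> /unitarymxP UU; rewrite mxtrace_mulC mulmxA UU mul1mx mxtrace_diag.
by rewrite rmorph_sum; apply: eq_bigr => i _; rewrite mxE.
Qed.

Lemma eig_incr_ge0 {d k} (F : k.-tuple 'cV[C]_d) i :
  0 <= eig_incr (frame_op F) 0 i.
Proof.
have [_ [V /unitarymxP VV e]] := eig_incr_diagonalization (frame_op_adj F).
rewrite -ler0c.
have -> : (eig_incr (frame_op F) 0 i)%:C =
    (V *m synthesis F *m (V *m synthesis F)^t*) i i.
  rewrite adjM mulmxA -(mulmxA V) -frame_op_synthesis {2}e.
  by rewrite !mulmxA VV mul1mx -mulmxA VV mulmx1 !mxE eqxx.
by rewrite gram_diagE; apply: sumr_ge0 => j _; exact: exprn_ge0.
Qed.

(** The cut at level t tells which vectors of the completion the staircase must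
    avoid: the first p ones. *)
Lemma completion_majorizes {d k n0} (F0 : n0.-tuple 'cV[C]_d) (a : 'rV[R]_k)
    (mu gamma : 'rV[R]_d) : (d <= k)%N ->
  tr mu = tr a -> tail_cuts a (eig_incr (frame_op F0)) mu ->
  Lambda F0 a gamma ->
  decr (eig_incr (frame_op F0) + mu) ≺ gamma.
Proof.
move=> dk tr_mu cuts [F [G Ga ->] <-] /=.
have Xa j : \sum_i `|synthesis G i j| ^+ 2 = (a 0 j)%:C.
  by rewrite -Ga; apply: eq_bigr => i _; rewrite mxE.
have [lami [V Vu SV]] := eig_incr_diagonalization (frame_op_adj F0).
move: (eig_incr _) cuts lami SV => lam cuts lami SV.
have [U Uu [x Sx]] := hermitian_diagonalization (frame_op_adj [tuple of F0 ++ G]).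
rewrite Sx eig_decr_diag //.
suff [h1 h2] : lam + mu ≺ x.
  by split; rewrite ?tr_decr // => p; rewrite !sort_decr_decr.
have SE : V^t* *m rdiag lam *m V + synthesis G *m (synthesis G)^t*
    = U^t* *m rdiag x *m U.
  by rewrite -SV -Sx -frame_op_synthesis -frame_op_cat.
apply: hinge_majorized => [|t].
  apply: complexI; rewrite trD tr_mu -[RHS](trace_rdiag x Uu) -SE.
  rewrite mxtraceD trace_rdiag // trace_synthesis [LHS]rmorphD; congr (_ + _).
  by rewrite rmorph_sum; apply: eq_bigr => j _; rewrite Xa.
have [p pP sump] := cuts t.
under eq_bigl do rewrite mxE; under eq_bigr do rewrite mxE.
have := @staircase_bound _ d k V U (synthesis G) (map_mx (real_complex R) lam)
  (map_mx (real_complex R) x)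
  (\row_i (Num.max 0 (t - x 0 i))%:C) t%:C p (fun c => lam 0 c + mu 0 c <= t)
  dk Vu Uu SE.
have -> : \sum_(c | lam 0 c + mu 0 c <= t) (t%:C - map_mx (real_complex R) lam 0 c)
   - \sum_(j < k | (p <= j)%N) \sum_i `|synthesis G i j| ^+ 2
  = (\sum_(c | lam 0 c + mu 0 c <= t) (t - (lam 0 c + mu 0 c)))%:C.
  under eq_bigr do rewrite mxE -rmorphB.
  under [X in _ - X]eq_bigr do rewrite Xa.
  rewrite -!rmorph_sum -rmorphB /= -sump !sumrB big_split /=.
  by congr _%:C; ring.
have -> : \sum_i (\row_i (Num.max 0 (t - x 0 i))%:C) 0 i =
   (\sum_i Num.max 0 (t - x 0 i))%:C :> C.
  by rewrite rmorph_sum; apply: eq_bigr => i _; rewrite mxE.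
rewrite lecR; apply=> //.
- by move=> i j ij; rewrite !mxE lecR lami.
- by move=> i; rewrite mxE ler0c le_max lexx.
- by move=> i; rewrite !mxE -rmorphB lecR le_max lexx orbT.
Qed.

(** The added frame operator is taken diagonal in the ordered eigenbasis of the
    initial one, so that the spectra add coordinatewise. *)
Lemma optimal_spectrum_attained {d k n0} (F0 : n0.-tuple 'cV[C]_d) (a : 'rV[R]_k)
    (mu : 'rV[R]_d) : (d <= k)%N -> a = decr a -> Gamma a mu ->
  Lambda F0 a (decr (eig_incr (frame_op F0) + mu)).
Proof.
move=> dk ad /(GammaE _ ad)[[mu0 mup mut] _].
have and_ : nonincreasing a by rewrite ad; exact: decr_nonincreasing.
have [X [XX Xa]] := schur_horn dk and_ mu0 mup mut.
have [_ [V Vu SV]] := eig_incr_diagonalization (frame_op_adj F0).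
move: (eig_incr _) SV => lam SV.
pose G : k.-tuple 'cV[C]_d := [tuple col j (V^t* *m X) | j < k].
have synG : synthesis G = V^t* *m X.
  by apply/matrixP => i j; rewrite mxE tnth_mktuple mxE.
exists [tuple of F0 ++ G].
  exists G => // j; rewrite -Xa tnth_mktuple.
  transitivity (\sum_i `|(V^t* *m X) i j| ^+ 2).
    by apply: eq_bigr => i _; rewrite mxE.
  rewrite !gram_colE adjM trmxCK mulmxA -(mulmxA _ V).
  by move/unitarymxP: Vu => ->; rewrite mulmx1.
rewrite /= -(eig_decr_diag _ Vu); congr eig_decr.
rewrite frame_op_cat SV (frame_op_synthesis G) synG adjM trmxCK.
rewrite mulmxA -(mulmxA _ X) XX -mulmxDl -mulmxDr; congr (_ *m _ *m _).
by rewrite -[LHS]linearD /= -map_mxD.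
Qed.

End Completions.

Unset Implicit Arguments.

Theorem theorem4p7 (R : realType) (d k n0 : nat)
    (F0 : n0.-tuple 'cV[R[i]]_d) (a : 'rV[R]_k) (lambda : 'rV[R]_d) :
  (0 < d)%N ->
  initial_data F0 a ->
  (d <= k)%N ->
  lambda = eig_incr (frame_op F0) ->
  exists nu : 'rV[R]_d,
    [/\ forall f : R -> R,
          (forall x : R, 0 <= x -> 0 <= f x) -> strictly_convex_nonneg f ->
          is_nu f lambda a nu,
        Lambda F0 a (decr nu)
      & forall gamma : 'rV[R]_d, Lambda F0 a gamma -> decr nu ≺ gamma].
Proof.
move=> d0 [a0 ad _] dk ->; set lam := eig_incr _.
have [lami _] := eig_incr_diagonalization (frame_op_adj F0).
have [mu muG cuts] := exists_tail_cuts d0 (fun i => ltW (a0 i)) ad lami.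
have [muP _] := (GammaE mu ad).1 muG.
exists (lam + mu); split=> [f _ cf||gamma].
- exists mu => //; apply: is_mu_least => //; first exact: eig_incr_ge0.
  move=> g /(GammaE _ ad)[gP _]; exact: tail_cuts_majorized cuts.
- exact: optimal_spectrum_attained.
- by apply: completion_majorizes => //; case: muP.
Qed.
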